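(* Let $G$ be an infinite locally finite $p$-group. Then the proper power graph $P^*(G)$ is connected if and only if $G\cong C_{p^{\infty}}$ for some prime number $p$, or $G\cong Q_{2^{\infty}}$.
   Context: The power graph $P(G)$ of a group $G$ is the undirected graph with vertex set $G$ in which two distinct elements are adjacent if and only if one of them is a positive power of the other; the proper power graph $P^*(G)$ is its induced subgraph on $G\setminus\{1\}$. A group is locally finite if every finitely generated subgroup is finite. A $p$-group ($p$ prime) is a group in which every element has order a power of $p$. $C_{p^\infty}$ denotes the $p$-quasicyclic (Prüfer) group, i.e. the $p$-primary component of $\mathbb{Q}/\mathbb{Z}$. For $n\ge 3$, $Q_{2^n}=\langle a,b\mid a^{2^{n-2}}=b^2,\ bab^{-1}=a^{-1},\ b^4=1\rangle$ is the generalized quaternion group of order $2^n$, and $Q_{2^\infty}=\bigcup_{i\ge 3}Q_{2^i}$ is the union of the chain in which $Q_{2^i}$ is embedded in $Q_{2^{i+1}}$ by sending $a\mapsto a^2$, $b\mapsto b$. *)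

(* Defs.v *)
From HB Require Import structures.
From mathcomp Require Import all_boot all_order all_algebra.
From mathcomp Require Import zify.
From mathcomp Require Import boolp classical_sets functions cardinality.

Set Implicit Arguments.
Unset Strict Implicit.
Unset Printing Implicit Defensive.

Import GRing.Theory.

Local Open Scope classical_set_scope.
Local Open Scope group_scope.

Definition is_subgroup (G : groupType) (H : set G) : Prop :=
  [/\ H 1, (forall x y, H x -> H y -> H (x * y)) & (forall x, H x -> H x^-1)].

Definition generated (G : groupType) (A : set G) : set G :=
  smallest (@is_subgroup G) A.

Definition finitely_generated (G : groupType) (H : set G) : Prop :=
  exists A : set G, finite_set A /\ H = generated A.

Definition locally_finite (G : groupType) : Prop :=
  forall H : set G, finitely_generated H -> finite_set H.

Definition has_order (G : groupType) (x : G) (n : nat) : Prop :=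
  [/\ (0 < n)%N, x ^+ n = 1 & forall m, (0 < m < n)%N -> x ^+ m <> 1].

Definition p_group (p : nat) (G : groupType) : Prop :=
  forall x : G, exists k, has_order x (p ^ k)%N.

Definition isomorphic (G H : groupType) : Prop :=
  exists f : {multiplicative G -> H}, bijective f.

Record graph := Graph { vertex :> Type; adjacent : vertex -> vertex -> Prop }.

Definition induced_subgraph (Gamma : graph) (A : set Gamma) : graph :=
  @Graph {x : Gamma | A x} (fun x y => adjacent (sval x) (sval y)).

Definition connected (Gamma : graph) : Prop :=
  forall x y : Gamma, exists s : seq Gamma,
    path (fun u v => `[< adjacent u v >]) x s /\ last x s = y.

Definition positive_power (G : groupType) (x y : G) : Prop :=
  exists n, (0 < n)%N /\ y = x ^+ n.

Definition power_graph (G : groupType) : graph :=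
  @Graph G (fun x y => x <> y /\ (positive_power x y \/ positive_power y x)).

Definition proper_power_graph (G : groupType) : graph :=
  @induced_subgraph (power_graph G) [set x : G | x <> 1].

Definition rat_int : {pred rat} := fun x => x \is a Num.int.

Lemma rat_int_closed : GRing.zmod_closed rat_int.
Proof. by split=> [|x y]; [apply: rpred0 | apply: rpredB]. Qed.

HB.instance Definition _ := GRing.isZmodClosed.Build rat rat_int rat_int_closed.

Definition rat_mod_int : zmodType := Quotient.quot rat_int.

(* [to_multiplicative] is only a change of notation: the law is addition. *)
Definition primary_pred (p : nat) : pred (Algebra.to_multiplicative rat_mod_int) :=
  fun x => `[< exists k, x ^+ (p ^ k) = 1 >].

Lemma primary_closed p : group_closed (primary_pred p).
Proof.
split; first by apply/asboolP; exists 0%N.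
move=> x y /asboolP[k xk] /asboolP[l yl]; apply/asboolP; exists (k + l)%N.
rewrite expgnFl; last exact: (@GRing.addrC rat_mod_int).
by rewrite expnD expgnA xk mulnC expgnA yl !expg1n divg1.
Qed.

Record prufer (p : nat) : Type := Prufer {
  prufer_val : Algebra.to_multiplicative rat_mod_int;
  _ : primary_pred p prufer_val
}.

HB.instance Definition _ p := [isSub for @prufer_val p].
HB.instance Definition _ p := [Choice of prufer p by <:].
HB.instance Definition _ p :=
  SubChoice_isSubGroup.Build _ (primary_pred p) (prufer p) (primary_closed p).

Section Presentation.
Variable I : choiceType.

(* [(i, false)] is the generator [i] and [(i, true)] its formal inverse. *)
Definition word := seq (I * bool).

Implicit Types u v w : word.

Definition inv_letter (l : I * bool) := (l.1, ~~ l.2).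
Definition inv_word w : word := rev (map inv_letter w).
Definition gen_word (i : I) : word := [:: (i, false)].
Definition power_word w k : word := flatten (nseq k w).

Variable R : word -> word -> Prop.

Inductive word_cong : word -> word -> Prop :=
| word_cong_rel u v : R u v -> word_cong u v
| word_cong_inv l : word_cong [:: l; inv_letter l] [::]
| word_cong_refl u : word_cong u u
| word_cong_sym u v : word_cong u v -> word_cong v u
| word_cong_trans u v w : word_cong u v -> word_cong v w -> word_cong u w
| word_cong_cat u u' v v' :
    word_cong u u' -> word_cong v v' -> word_cong (u ++ v) (u' ++ v').

Definition word_congb u v := `[< word_cong u v >].

Lemma word_congb_equiv : equiv_class_of word_congb.
Proof.
split=> [u|u v|v u w].
- exact/asboolP/word_cong_refl.
- by apply/asboolP/asboolP => /word_cong_sym.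
- move=> /asboolP uv /asboolP vw; apply/asboolP.
  exact: word_cong_trans uv vw.
Qed.

Canonical word_cong_equiv_rel := EquivRelPack word_congb_equiv.

Definition presented := {eq_quot word_congb}%qT.
HB.instance Definition _ := Choice.on presented.
HB.instance Definition _ := Quotient.on presented.
HB.instance Definition _ := EqQuotient.on presented.

Local Open Scope quotient_scope.

Lemma presented_eq u v : \pi_presented u = \pi_presented v <-> word_cong u v.
Proof.
split=> [/eqmodP/asboolP //|uv]; exact/eqmodP/asboolP.
Qed.

Lemma word_cong_repr u : word_cong (repr (\pi_presented u)) u.
Proof. by apply/presented_eq; rewrite reprK. Qed.

Lemma inv_letterK : involutive inv_letter.
Proof. by case=> i b; rewrite /inv_letter negbK. Qed.

Lemma word_cong_mulV w : word_cong (w ++ inv_word w) [::].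
Proof.
elim: w => [|l w IH]; first exact: word_cong_refl.
have -> : (l :: w) ++ inv_word (l :: w) =
    [:: l] ++ ((w ++ inv_word w) ++ [:: inv_letter l]).
  by rewrite /inv_word /= rev_cons -cats1 catA.
apply: word_cong_trans (word_cong_inv l).
apply: word_cong_cat (word_cong_refl [:: l]) _.
exact: word_cong_cat IH (word_cong_refl _).
Qed.

Lemma inv_wordK : involutive inv_word.
Proof.
by move=> w; rewrite /inv_word map_rev revK -map_comp map_id_in // => l _ /=;
  rewrite inv_letterK.
Qed.

Lemma word_cong_Vmul w : word_cong (inv_word w ++ w) [::].
Proof. by have := word_cong_mulV (inv_word w); rewrite inv_wordK. Qed.

Lemma word_cong_invw u v : word_cong u v -> word_cong (inv_word u) (inv_word v).
Proof.
move=> uv; rewrite -[inv_word u]cats0.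
apply: (@word_cong_trans _ (inv_word u ++ (v ++ inv_word v))).
  apply: word_cong_cat (word_cong_refl _) _.
  exact/word_cong_sym/word_cong_mulV.
rewrite catA -[X in word_cong _ X]cat0s.
apply: word_cong_cat (word_cong_refl _).
apply: word_cong_trans (word_cong_Vmul u).
exact: word_cong_cat (word_cong_refl _) (word_cong_sym uv).
Qed.

Definition presented_one : presented := \pi_presented [::].
Definition presented_mul (x y : presented) : presented := \pi_presented (repr x ++ repr y).
Definition presented_inv (x : presented) : presented := \pi_presented (inv_word (repr x)).

Lemma presented_mulA : associative presented_mul.
Proof.
move=> x y z; apply/presented_eq.
apply: (@word_cong_trans _ (repr x ++ (repr y ++ repr z))).
  exact: word_cong_cat (word_cong_refl _) (word_cong_repr _).
rewrite catA; apply: word_cong_cat (word_cong_refl _).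
exact/word_cong_sym/word_cong_repr.
Qed.

Lemma presented_mul1 : left_id presented_one presented_mul.
Proof.
move=> x; rewrite -[RHS]reprK; apply/presented_eq.
rewrite -[X in word_cong _ X]cat0s.
exact: word_cong_cat (word_cong_repr _) (word_cong_refl _).
Qed.

Lemma presented_mulr1 : right_id presented_one presented_mul.
Proof.
move=> x; rewrite -[RHS]reprK; apply/presented_eq.
rewrite -[X in word_cong _ X]cats0.
exact: word_cong_cat (word_cong_refl _) (word_cong_repr _).
Qed.

Lemma presented_mulV : left_inverse presented_one presented_inv presented_mul.
Proof.
move=> x; apply/presented_eq; apply: word_cong_trans (word_cong_Vmul (repr x)).
exact: word_cong_cat (word_cong_repr _) (word_cong_refl _).
Qed.

Lemma presented_mulrV : right_inverse presented_one presented_inv presented_mul.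
Proof.
move=> x; apply/presented_eq; apply: word_cong_trans (word_cong_mulV (repr x)).
exact: word_cong_cat (word_cong_refl _) (word_cong_repr _).
Qed.

HB.instance Definition _ := isGroup.Build presented
  presented_mulA presented_mul1 presented_mulr1 presented_mulV presented_mulrV.

Definition generator (i : I) : presented := \pi_presented (gen_word i).

Section Lift.
Variables (H : groupType) (f : I -> H).

Definition eval_letter (l : I * bool) : H := if l.2 then (f l.1)^-1 else f l.1.

Definition eval_word w : H := \prod_(l <- w) eval_letter l.

Lemma eval_gen_word i : eval_word (gen_word i) = f i.
Proof. by rewrite /eval_word big_seq1. Qed.

Lemma eval_cat u v : eval_word (u ++ v) = eval_word u * eval_word v.
Proof. exact: big_cat. Qed.

Lemma eval_inv_word w : eval_word (inv_word w) = (eval_word w)^-1.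
Proof.
elim: w => [|[i c] w IH]; first by rewrite /eval_word !big_nil invg1.
rewrite -cat1s {1}/inv_word map_cat rev_cat !eval_cat IH invgM.
rewrite [X in _ * X]/eval_word [in RHS]/eval_word !big_seq1 /eval_letter /=.
by case: c; rewrite /= ?invgK.
Qed.

Lemma eval_power_word w k : eval_word (power_word w k) = eval_word w ^+ k.
Proof.
elim: k => [|k IH]; first by rewrite /eval_word big_nil.
by rewrite expgS -IH -eval_cat.
Qed.

Definition presented_lift (x : presented) : H := eval_word (repr x).

Hypothesis fR : forall u v, R u v -> eval_word u = eval_word v.

Lemma eval_word_cong u v : word_cong u v -> eval_word u = eval_word v.
Proof.
elim=> {u v} [u v /fR //|[i b]|//|u v _ -> //|u v w _ -> _ -> //|].
- rewrite /eval_word !big_cons !big_nil mulg1 /eval_letter /=.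
  by case: b; rewrite /= ?mulgV ?mulVg.
- by move=> u u' v v' _ uu' _ vv'; rewrite /eval_word !big_cat -!/(eval_word _) uu' vv'.
Qed.

Lemma presented_liftM : {morph presented_lift : x y / x * y}.
Proof.
move=> x y; rewrite /presented_lift (eval_word_cong (word_cong_repr _)).
by rewrite /eval_word big_cat.
Qed.

Lemma presented_lift_gen i : presented_lift (generator i) = f i.
Proof.
rewrite /presented_lift (eval_word_cong (word_cong_repr _)).
exact: eval_gen_word.
Qed.

End Lift.

Lemma presented_piM u v :
  \pi_presented (u ++ v) = \pi_presented u * \pi_presented v.
Proof.
by apply/presented_eq/word_cong_sym; apply: word_cong_cat; apply: word_cong_repr.
Qed.

Lemma presented_eval u : eval_word generator u = \pi_presented u.
Proof.
elim: u => [|[i b] u IH]; first by rewrite /eval_word big_nil.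
rewrite -cat1s presented_piM -IH /eval_word big_cat big_seq1; congr (_ * _).
case: b => //; rewrite /eval_letter /=; apply/presented_eq.
exact: (word_cong_invw (word_cong_repr [:: (i, false)])).
Qed.

Lemma presented_rel u v : R u v -> eval_word generator u = eval_word generator v.
Proof.
by move=> uv; rewrite !presented_eval; apply/presented_eq/word_cong_rel.
Qed.

End Presentation.

Section ChainLimit.
Variables (G : nat -> groupType) (phi : forall n, {multiplicative G n -> G n.+1}).

Definition chain_elt := {n & G n}.
HB.instance Definition _ := Choice.on chain_elt.

Implicit Types u v w : chain_elt.

Definition chain_step u : chain_elt := Tagged G (phi (tag u) (tagged u)).
Definition chain_steps k u : chain_elt := iter k chain_step u.

(* An equality in [chain_elt] forces both sides to lie in the same [G n]. *)
Definition chain_equiv u v : bool :=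
  `[< exists k l, chain_steps k u = chain_steps l v >].

Lemma chain_equiv_equiv : equiv_class_of chain_equiv.
Proof.
split=> [u|u v|v u w].
- by apply/asboolP; exists 0%N, 0%N.
- by apply/asboolP/asboolP => -[k [l e]]; exists l, k.
- move=> /asboolP[k [l e]] /asboolP[k' [l' e']]; apply/asboolP.
  exists (k' + k)%N, (l + l')%N; rewrite /chain_steps addnC in e e' *.
  by rewrite (addnC k k') !iterD e -e' -!iterD addnC.
Qed.

Canonical chain_equiv_rel := EquivRelPack chain_equiv_equiv.

Definition chain_limit := {eq_quot chain_equiv}%qT.
HB.instance Definition _ := Choice.on chain_limit.
HB.instance Definition _ := Quotient.on chain_limit.
HB.instance Definition _ := EqQuotient.on chain_limit.

Local Open Scope quotient_scope.

(* Only used when [tag u = tag v]; [tagged_as u v] is [v] cast to [G (tag u)]. *)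
Definition level_mul u v : chain_elt := Tagged G (tagged u * tagged_as u v).

Definition chain_mul u v : chain_elt :=
  level_mul (chain_steps (tag v) u) (chain_steps (tag u) v).
Definition chain_inv u : chain_elt := Tagged G (tagged u)^-1.
Definition chain_one : chain_elt := Tagged G (1 : G 0).

Definition limit_mul (x y : chain_limit) : chain_limit :=
  \pi_chain_limit (chain_mul (repr x) (repr y)).
Definition limit_inv (x : chain_limit) : chain_limit := \pi_chain_limit (chain_inv (repr x)).
Definition limit_one : chain_limit := \pi_chain_limit chain_one.

Lemma limit_eq u v :
  \pi_chain_limit u = \pi_chain_limit v <->
  exists k l, chain_steps k u = chain_steps l v.
Proof. by split=> [/eqmodP/asboolP //|uv]; apply/eqmodP/asboolP. Qed.

Lemma pi_steps k u : \pi_chain_limit (chain_steps k u) = \pi_chain_limit u.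
Proof. by apply/limit_eq; exists 0%N, k. Qed.

Lemma tag_steps k u : tag (chain_steps k u) = (k + tag u)%N.
Proof. by elim: k => //= k ->. Qed.

Lemma level_mulE n (x y : G n) :
  level_mul (Tagged G x) (Tagged G y) = Tagged G (x * y).
Proof. by rewrite /level_mul tagged_asE. Qed.

Lemma step_mul u v : tag u = tag v ->
  chain_step (level_mul u v) = level_mul (chain_step u) (chain_step v).
Proof.
case: u v => [n x] [m y] /= e; case: m / e y => y.
by rewrite [RHS]level_mulE level_mulE /chain_step /= gmulfM.
Qed.

Lemma steps_mul k u v : tag u = tag v ->
  chain_steps k (level_mul u v) = level_mul (chain_steps k u) (chain_steps k v).
Proof.
by move=> e; elim: k => //= k ->; apply: step_mul; rewrite !tag_steps e.
Qed.

Lemma steps_inv k u : chain_steps k (chain_inv u) = chain_inv (chain_steps k u).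
Proof.
elim: k => //= k ->; case: (chain_steps k u) => n x.
rewrite /chain_step /chain_inv /=; congr (Tagged G _).
apply/esym/mulg1_eq; rewrite -gmulfM mulgV.
by apply: (mulgI (phi n x)); rewrite -gmulfM !mulg1.
Qed.

(* The product of two classes is computed in any [G n] that meets both. *)
Lemma pi_mul k l u v : (k + tag u = l + tag v)%N ->
  \pi_chain_limit (level_mul (chain_steps k u) (chain_steps l v)) =
  limit_mul (\pi_chain_limit u) (\pi_chain_limit v).
Proof.
have same k' l' k1 l1 u' v' u1 v1 : (k' + tag u' = l' + tag v')%N ->
    (k1 + tag u1 = l1 + tag v1)%N ->
    \pi_chain_limit u' = \pi_chain_limit u1 -> \pi_chain_limit v' = \pi_chain_limit v1 ->
  \pi_chain_limit (level_mul (chain_steps k' u') (chain_steps l' v')) =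
  \pi_chain_limit (level_mul (chain_steps k1 u1) (chain_steps l1 v1)).
  move=> e' e1 /limit_eq[a [b eu]] /limit_eq[c [d ev]].
  have tu : (a + tag u' = b + tag u1)%N by rewrite -!tag_steps eu.
  have tv : (c + tag v' = d + tag v1)%N by rewrite -!tag_steps ev.
  apply/limit_eq; exists (a + c + k1)%N, (b + c + k')%N.
  rewrite !steps_mul ?tag_steps // /chain_steps -!iterD; congr level_mul.
    have -> : (a + c + k1 + k' = (c + k1 + k') + a)%N by lia.
    have -> : (b + c + k' + k1 = (c + k1 + k') + b)%N by lia.
    by rewrite (iterD _ a) (iterD _ b) -/(chain_steps a u') eu.
  have -> : (a + c + k1 + l' = (a + k1 + l') + c)%N by lia.
  have -> : (b + c + k' + l1 = (a + k1 + l') + d)%N by lia.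
  by rewrite (iterD _ c) (iterD _ d) -/(chain_steps c v') ev.
move=> e; apply: same => //; rewrite ?reprK //; exact: addnC.
Qed.

Lemma pi_level_mul n (x y : G n) :
  \pi_chain_limit (Tagged G (x * y)) = limit_mul (\pi_chain_limit (Tagged G x)) (\pi_chain_limit (Tagged G y)).
Proof. by rewrite -level_mulE; apply: (@pi_mul 0 0). Qed.

Lemma pi_inv u : \pi_chain_limit (chain_inv u) = limit_inv (\pi_chain_limit u).
Proof.
have /limit_eq[k [l e]] : \pi_chain_limit u = \pi_chain_limit (repr (\pi_chain_limit u)).
  by rewrite reprK.
by apply/limit_eq; exists k, l; rewrite !steps_inv e.
Qed.

Lemma pi_one n : \pi_chain_limit (Tagged G (1 : G n)) = limit_one.
Proof.
have one1 m : chain_step (Tagged G (1 : G m)) = Tagged G (1 : G m.+1).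
  rewrite /chain_step /=; congr (Tagged G _).
  by apply: (mulgI (phi m 1)); rewrite -gmulfM !mulg1.
by apply/limit_eq; exists 0%N, n; elim: n => //= n <-; rewrite -one1.
Qed.

Lemma limit_level n (x : chain_limit) :
  (tag (repr x) <= n)%N -> exists a : G n, x = \pi_chain_limit (Tagged G a).
Proof.
move=> /subnK e; rewrite -[x]reprK -(pi_steps (n - tag (repr x))).
move: e; rewrite -tag_steps; case: (chain_steps _ _) => m a /= e.
by case: n / e; exists a.
Qed.

Lemma limit_mulA : associative limit_mul.
Proof.
move=> x y z; pose n := (tag (repr x) + tag (repr y) + tag (repr z))%N.
have [|a ->] := @limit_level n x; first by rewrite /n; lia.
have [|b ->] := @limit_level n y; first by rewrite /n; lia.
have [|c ->] := @limit_level n z; first by rewrite /n; lia.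
by rewrite -!pi_level_mul mulgA.
Qed.

Lemma limit_mul1 : left_id limit_one limit_mul.
Proof.
move=> x; have [|a ->] := @limit_level (tag (repr x)) x; first by [].
by rewrite -(pi_one (tag (repr x))) -pi_level_mul mul1g.
Qed.

Lemma limit_mulr1 : right_id limit_one limit_mul.
Proof.
move=> x; have [|a ->] := @limit_level (tag (repr x)) x; first by [].
by rewrite -(pi_one (tag (repr x))) -pi_level_mul mulg1.
Qed.

Lemma limit_mulV : left_inverse limit_one limit_inv limit_mul.
Proof.
move=> x; have [|a ->] := @limit_level (tag (repr x)) x; first by [].
by rewrite -pi_inv -pi_level_mul mulVg pi_one.
Qed.

Lemma limit_mulrV : right_inverse limit_one limit_inv limit_mul.
Proof.
move=> x; have [|a ->] := @limit_level (tag (repr x)) x; first by [].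
by rewrite -pi_inv -pi_level_mul mulgV pi_one.
Qed.

HB.instance Definition _ := isGroup.Build chain_limit
  limit_mulA limit_mul1 limit_mulr1 limit_mulV limit_mulrV.

Definition chain_in n (x : G n) : chain_limit := \pi_chain_limit (Tagged G x).

Lemma chain_inM n : {morph @chain_in n : x y / x * y}.
Proof. exact: pi_level_mul. Qed.

End ChainLimit.

Section Quaternion.
Variable n : nat.

(* The generators [a] and [b] are indexed by [false] and [true]. *)
Notation a := (gen_word false).
Notation b := (gen_word true).

Inductive quaternion_rel : word bool -> word bool -> Prop :=
| quaternion_rel_ab :
    quaternion_rel (power_word a (2 ^ (n - 2))) (power_word b 2)
| quaternion_rel_conj : quaternion_rel (b ++ a ++ inv_word b) (inv_word a)
| quaternion_rel_b : quaternion_rel (power_word b 4) [::].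

(* Meaningful for [n >= 3], when it has order [2 ^ n]. *)
Definition quaternion : groupType := presented quaternion_rel.

Definition quaternion_a : quaternion := generator quaternion_rel false.
Definition quaternion_b : quaternion := generator quaternion_rel true.

Lemma eval_quaternion_rel (H : groupType) (f : bool -> H) :
  f false ^+ (2 ^ (n - 2)) = f true ^+ 2 ->
  f true * f false * (f true)^-1 = (f false)^-1 -> f true ^+ 4 = 1 ->
  forall u v, quaternion_rel u v -> eval_word f u = eval_word f v.
Proof.
move=> ab conj b4 u v [].
- by rewrite !eval_power_word !eval_gen_word.
- by rewrite !eval_cat !eval_inv_word !eval_gen_word mulgA.
- by rewrite eval_power_word eval_gen_word b4 /eval_word big_nil.
Qed.

Lemma quaternion_relations :
  [/\ quaternion_a ^+ (2 ^ (n - 2)) = quaternion_b ^+ 2,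
      quaternion_b * quaternion_a * quaternion_b^-1 = quaternion_a^-1 &
      quaternion_b ^+ 4 = 1].
Proof.
split.
- by have := presented_rel quaternion_rel_ab;
    rewrite !eval_power_word !eval_gen_word.
- by have := presented_rel quaternion_rel_conj;
    rewrite !eval_cat !eval_inv_word !eval_gen_word mulgA.
- by have := presented_rel quaternion_rel_b;
    rewrite eval_power_word eval_gen_word /eval_word big_nil.
Qed.

End Quaternion.

Section QuaternionChain.
Variable i : nat.

Definition quaternion_images (x : bool) : quaternion i.+4 :=
  if x then quaternion_b i.+4 else quaternion_a i.+4 ^+ 2.

Definition quaternion_embed : quaternion i.+3 -> quaternion i.+4 :=
  presented_lift quaternion_images.

Lemma quaternion_images_rel u v : quaternion_rel i.+3 u v ->
  eval_word quaternion_images u = eval_word quaternion_images v.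
Proof.
have [ab conj b4] := quaternion_relations i.+4.
apply: eval_quaternion_rel => //=.
- by rewrite -expgnA -expnS -ab; congr (_ ^+ (2 ^ _)); lia.
- by rewrite -expVgn -conj !expg2 !mulgA mulgVK.
Qed.

HB.instance Definition _ := isMultiplicative.Build _ _ quaternion_embed
  (presented_liftM quaternion_images_rel).

Lemma quaternion_embed_a :
  quaternion_embed (quaternion_a i.+3) = quaternion_a i.+4 ^+ 2.
Proof. exact: (presented_lift_gen quaternion_images_rel). Qed.

Lemma quaternion_embed_b :
  quaternion_embed (quaternion_b i.+3) = quaternion_b i.+4.
Proof. exact: (presented_lift_gen quaternion_images_rel). Qed.

End QuaternionChain.

(* The inductive limit of the chain of [quaternion_embed] is the union: these
   maps are injective, as [a ^+ 2] and [b] generate a subgroup of order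
   [2 ^ i.+3] of [quaternion i.+4]. *)
Definition quaternion_infty : groupType :=
  @chain_limit (fun i => quaternion i.+3) quaternion_embed.

(* Main.v *)
From HB Require Import structures.
From mathcomp Require Import all_boot all_order all_algebra all_fingroup.
From mathcomp Require Import all_solvable zify.
From mathcomp Require Import boolp classical_sets functions cardinality.
Require Import Defs.

(** In a p-group every nontrivial element has a power of order [p], and the
    cyclic subgroups of a cyclic p-group form a chain.  Hence the order-[p]
    subgroup of [<x>] does not change along an edge of the proper power graph,
    and the graph is connected exactly when [G] has a single subgroup of order
    [p] ([connected_one_subgroup]): every vertex is then joined to each
    generator of that subgroup.

    It remains to classify the infinite locally finite p-groups with a single
    subgroup of order [p].  A finite p-group with this property is cyclic or
    generalized quaternion, so every finite subset of [G] lies in a cyclic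
    subgroup [<a>], or, when [p = 2], in [<a> U <a>b] with [b] of order 4
    inverting [a] ([finite_seq_cyclic_or_quaternion]).

    If the first case always occurs, then of any two elements one is a power of
    the other; as [G] is infinite this gives each element a p-th root, and
    iterating roots from an element of order [p] yields a tower
    [1, g_1, g_2, ...] with [g_(n+1) ^ p = g_n] whose powers exhaust [G]
    ([comparable_tower]).  Otherwise [p = 2], and the powers of the elements of
    order at least 8 form a subgroup [A] to which the same argument applies;
    any [b] outside [A] inverts [A], has square [g_1], and satisfies
    [G = A U Ab] ([quasiquaternion_of_not_locally_cyclic]).

    Such towers determine the group, because whether a normal form [g_n^i] or
    [g_n^i b^e] is trivial, and how two normal forms multiply, depends only on
    the exponents ([quasicyclic_iso], [quasiquaternion_iso]).  The theorem
    follows since the Prufer group carries the tower [1/p^n]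
    ([prufer_quasicyclic]) and the union of the quaternion groups carries the
    tower of the elements [a^4] of its successive levels
    ([quasiquaternion_infty]). *)

Set Implicit Arguments.
Unset Strict Implicit.
Unset Printing Implicit Defensive.

Import GRing.Theory Num.Theory.

Local Open Scope classical_set_scope.
Local Open Scope group_scope.

(** * Homomorphisms and powers *)

Section Homomorphism.
Variables (G H : groupType) (f : {multiplicative G -> H}).

Lemma homomorphism1 : f 1 = 1.
Proof. by apply: (mulgI (f 1)); rewrite -gmulfM !mulg1. Qed.

Lemma homomorphismX n : {morph f : x / x ^+ n}.
Proof.
by move=> x; elim: n => [|n IH]; rewrite ?homomorphism1 // !expgS gmulfM IH.
Qed.

Lemma homomorphismV : {morph f : x / x^-1}.
Proof.
by move=> x; apply/esym/mulg1_eq; rewrite -gmulfM mulgV homomorphism1.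
Qed.

End Homomorphism.

Definition powers (G : groupType) (x : G) : set G :=
  [set y | exists n, y = x ^+ n].

Lemma powers_refl (G : groupType) (x : G) : powers x x.
Proof. by exists 1%N. Qed.

Lemma powersX (G : groupType) (x : G) n : powers x (x ^+ n).
Proof. by exists n. Qed.

Lemma powers_trans (G : groupType) (x y z : G) :
  powers x y -> powers y z -> powers x z.
Proof. by move=> [m ->] [n ->]; exists (m * n)%N; rewrite expgnA. Qed.

Lemma powers_expg (G : groupType) (x y : G) n : powers x y -> powers x (y ^+ n).
Proof. by move=> xy; apply: powers_trans xy (powersX _ _). Qed.

Lemma expg_dvdn_eq1 (G : groupType) (x : G) N i :
  x ^+ N = 1 -> N %| i -> x ^+ i = 1.
Proof. by move=> xN /dvdnP[k ->]; rewrite mulnC expgnA xN expg1n. Qed.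

Lemma expg_modn (G : groupType) (x : G) N n :
  x ^+ N = 1 -> x ^+ (n %% N) = x ^+ n.
Proof.
move=> xN; rewrite [in RHS](divn_eq n N) expgnDr mulnC expgnA xN.
by rewrite expg1n mul1g.
Qed.

(** Lets normal forms keep natural exponents, which elements of two different
    groups can share. *)
Lemma invg_expg_pred (G : groupType) (x : G) N :
  (0 < N)%N -> x ^+ N = 1 -> x^-1 = x ^+ N.-1.
Proof. by move=> N0 xN; apply: (mulgI x); rewrite mulgV -expgS prednK. Qed.

(** Bezout: [gcdn N i] is a multiple of [i] modulo [N]. *)
Lemma powers_gcd (G : groupType) (x : G) N i :
  (0 < N)%N -> x ^+ N = 1 -> powers (x ^+ i) (x ^+ gcdn N i).
Proof.
move=> N0 xN; have [a _ /(expg_dvdn_eq1 xN) e] := Bezoutl i N0.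
exists (N.-1 * a)%N; rewrite -expgnA mulnCA expgnA -expgnAC.
rewrite -(invg_expg_pred N0); last by rewrite -expgnA mulnC expgnA xN expg1n.
by apply: (mulIg (x ^+ (a * i))); rewrite -expgnDr e mulnC mulVg.
Qed.

Lemma powers_coprime (G : groupType) (x : G) N i :
  (0 < N)%N -> x ^+ N = 1 -> coprime N i -> powers (x ^+ i) x.
Proof. by move=> N0 xN /eqP e; have := powers_gcd i N0 xN; rewrite e. Qed.

(** A group of prime order is generated by each of its nontrivial elements. *)
Lemma powers_prime_sym (p : nat) (G : groupType) (x y : G) : prime p ->
  x ^+ p = 1 -> powers x y -> y <> 1 -> powers y x.
Proof.
move=> p_pr xp [i ->] y1; apply: (powers_coprime (prime_gt0 p_pr) xp).
by rewrite prime_coprime //; apply/negP => /(expg_dvdn_eq1 xp).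
Qed.

(** If [c] has order [p ^ k], then [c ^ i] generates the same subgroup as
    [c ^ gcd (p ^ k, i)], whose exponent is a power of [p]; and powers of [p]
    are totally ordered by divisibility. *)
Lemma powers_total (p : nat) (G : groupType) (c x y : G) : prime p ->
  p_group p G -> powers c x -> powers c y -> powers x y \/ powers y x.
Proof.
move=> p_pr pG [i ->] [j ->]; have [k [N0 cN _]] := pG c.
pose l n := logn p (gcdn (p ^ k) n).
wlog : i j / l i <= l j.
  by move=> W; case/orP: (leq_total (l i) (l j)) => /W // [|]; [right|left].
have /(dvdn_pfactor _ _ p_pr)[u _ eu] := dvdn_gcdl (p ^ k) i.
have /(dvdn_pfactor _ _ p_pr)[v _ ev] := dvdn_gcdl (p ^ k) j.
rewrite /l eu ev !pfactorK // => uv; left.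
apply: powers_trans (powers_gcd i N0 cN) _; rewrite eu.
have /dvdnP[m ->] : p ^ u %| j.
  by apply: dvdn_trans (dvdn_exp2l p uv) _; rewrite -ev dvdn_gcdr.
by exists m; rewrite mulnC expgnA.
Qed.

Lemma powers_prime_order (p : nat) (G : groupType) (x : G) : prime p ->
  p_group p G -> x <> 1 -> exists y, [/\ powers x y, y <> 1 & y ^+ p = 1].
Proof.
move=> p_pr pG x1; have [[|k] [_ xk min]] := pG x; first by rewrite expg1 in xk.
exists (x ^+ (p ^ k)); split; first exact: powersX.
- by apply: min; rewrite expn_gt0 prime_gt0 //= ltn_exp2l ?prime_gt1.
- by rewrite -expgnA -expnSr.
Qed.

Lemma prime_order_eq (p q : nat) (G : groupType) (x : G) : prime p -> prime q ->
  p_group p G -> x <> 1 -> x ^+ q = 1 -> p = q.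
Proof.
move=> p_pr q_pr pG x1 xq; have [k [_ xk _]] := pG x.
apply/eqP; apply: contra_notT x1 => pq.
have [|j ->] := powers_coprime (i := p ^ k) (prime_gt0 q_pr) xq.
  by rewrite coprimeXr // prime_coprime // dvdn_prime2 // eq_sym.
by rewrite xk expg1n.
Qed.

Lemma finite_powers (p : nat) (G : groupType) (x : G) :
  p_group p G -> finite_set (powers x).
Proof.
move=> /(_ x)[k [N0 xN _]]; pose s := [seq x ^+ i | i <- iota 0 (p ^ k)].
apply: (sub_finite_set _ (finite_seq s)) => _ [n ->] /=; apply/mapP.
by exists (n %% p ^ k); rewrite ?expg_modn // mem_iota /= add0n ltn_mod.
Qed.

(** * Connectedness of the proper power graph *)

(** Stated on generators: any two elements of order [p] generate the same
    subgroup.  The existence of such elements is not part of it. *)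
Definition one_subgroup_of_order (p : nat) (G : groupType) : Prop :=
  forall x y : G, x <> 1 -> y <> 1 -> x ^+ p = 1 -> y ^+ p = 1 -> powers x y.

Definition joined (Gamma : graph) (x y : Gamma) : Prop :=
  exists s : seq Gamma,
    path (fun u v => `[< adjacent u v >]) x s /\ last x s = y.

Lemma joined_trans (Gamma : graph) (x y z : Gamma) :
  joined x y -> joined y z -> joined x z.
Proof.
move=> [s [xs <-]] [t [yt <-]]; exists (s ++ t).
by rewrite cat_path last_cat xs yt.
Qed.

Lemma joined_powers (G : groupType) (x y : proper_power_graph G) :
  powers (sval x) (sval y) \/ powers (sval y) (sval x) -> joined x y.
Proof.
move: x y => [x x1] [y y1] /=.
have [e|xy P] := pselect (x = y).
  by move=> _; exists [::]; split=> //=; apply: eq_exist.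
have pos u v : v <> 1 :> G -> powers u v -> positive_power u v.
  by move=> v1 [[|n] e] //; exists n.+1.
exists [:: exist _ y y1]; split=> //=; rewrite andbT; apply/asboolP.
by split=> //=; case: P => /pos H; [left|right]; apply: H.
Qed.

(** Along an edge the set of elements of order [p] that are powers of the
    current vertex is preserved, since a cyclic p-group has one subgroup of
    order [p]; this gives the direct implication. *)
Lemma connected_one_subgroup (p : nat) (G : groupType) : prime p ->
  p_group p G ->
  connected (proper_power_graph G) <-> one_subgroup_of_order p G.
Proof.
move=> p_pr pG; split=> [conn x y x1 y1 xp yp|one [x x1] [y y1]].
  have edge u v : powers u x -> v <> 1 ->
      positive_power u v \/ positive_power v u -> powers v x.
    move=> ux v1 [[n [_ ev]]|[n [_ eu]]]; last first.
      by apply: powers_trans ux; exists n.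
    have [//|xv] := powers_total p_pr pG (ex_intro _ _ ev : powers u v) ux.
    exact: powers_prime_sym p_pr xp xv v1.
  have [s [xs ys]] := conn (exist _ x x1) (exist _ y y1).
  suff yx : powers y x by apply: powers_prime_sym p_pr yp yx x1.
  rewrite -[y]/(sval (exist (fun x => x <> 1) y y1)) -{}ys.
  have : powers (sval (exist (fun x => x <> 1) x x1)) x by apply: powers_refl.
  elim: s (exist _ _ _) xs => //= v s IH u /andP[/asboolP[_ uv] sv] ux.
  apply: IH sv _; apply: edge ux _ uv; exact: (svalP v).
have [x' [xx' x'1 x'p]] := powers_prime_order p_pr pG x1.
have [y' [yy' y'1 y'p]] := powers_prime_order p_pr pG y1.
pose vertex z (z1 : z <> 1) : proper_power_graph G := exist _ z z1.
apply: (@joined_trans _ _ (vertex _ x'1)); first by apply: joined_powers; left.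
apply: (@joined_trans _ _ (vertex _ y'1)); apply: joined_powers.
  by left; apply: one.
by right.
Qed.

(** Only [p] can be the order of a nontrivial element when this order is a
    prime, so the element of order [q] in [H] forces [q = p]; the property of
    having one subgroup of order [p] then transports along the isomorphism. *)
Lemma connected_of_isomorphic (p q : nat) (G H : groupType) : prime p ->
  prime q -> p_group p G -> isomorphic G H -> one_subgroup_of_order q H ->
  (exists y : H, y <> 1 /\ y ^+ q = 1) -> connected (proper_power_graph G).
Proof.
move=> p_pr q_pr pG [f [f' fK f'K]] oneH [y [y1 yq]].
have f1 x : x <> 1 -> f x <> 1.
  by move=> x1 fx; apply: x1; rewrite -(fK x) fx -(homomorphism1 f) fK.
have e : p = q.
  apply: (prime_order_eq p_pr q_pr pG (x := f' y)).
    by move=> fy; apply: y1; rewrite -(f'K y) fy homomorphism1.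
  by rewrite -(fK (f' y ^+ q)) homomorphismX f'K yq -(homomorphism1 f) fK.
subst q; apply/(connected_one_subgroup p_pr pG) => x z x1 z1 xp zp.
have [||n fz] := oneH (f x) (f z) (f1 _ x1) (f1 _ z1).
- by rewrite -homomorphismX xp homomorphism1.
- by rewrite -homomorphismX zp homomorphism1.
by exists n; rewrite -(fK z) fz -homomorphismX fK.
Qed.

(** * Towers of p-th roots *)

(** Multiplicativity reduces single-valuedness and injectivity of [r] to the
    preservation of triviality: if [r x y] and [r x y'], multiply both by some
    [r x^-1 z].  This builds an isomorphism from normal forms that are not
    unique. *)
Lemma isomorphic_rel (G H : groupType) (r : G -> H -> Prop) :
  (forall x, exists y, r x y) -> (forall y, exists x, r x y) ->
  (forall x y x' y', r x y -> r x' y' -> r (x * x') (y * y')) ->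
  (forall x y, r x y -> x = 1 <-> y = 1) -> isomorphic G H.
Proof.
move=> totG totH rM r1.
have r_fun x y y' : r x y -> r x y' -> y = y'.
  move=> xy xy'; have [z xz] := totG x^-1; apply: (mulIg z).
  have /r1[/(_ (mulgV x)) -> _] := rM _ _ _ _ xy xz.
  by have /r1[/(_ (mulgV x)) -> _] := rM _ _ _ _ xy' xz.
have r_inj x x' y : r x y -> r x' y -> x = x'.
  move=> xy xy'; have [z xz] := totH y^-1; apply: (mulIg z).
  have /r1[_ /(_ (mulgV y)) ->] := rM _ _ _ _ xy xz.
  by have /r1[_ /(_ (mulgV y)) ->] := rM _ _ _ _ xy' xz.
have [f rf] := choice totG; have [f' rf'] := choice totH.
have fM : {morph f : x y / x * y}.
  by move=> x y; apply: r_fun (rf _) _; apply: rM.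
pose fm : {multiplicative G -> H} :=
  HB.pack_for {multiplicative G -> H} f (isMultiplicative.Build G H f fM).
exists fm; exists f' => x; first exact: r_inj (rf' _) (rf _).
exact: r_fun (rf _) (rf' _).
Qed.

Definition tower (p : nat) (G : groupType) (g : nat -> G) : Prop :=
  [/\ g 0%N = 1, g 1%N <> 1 & forall n, g n.+1 ^+ p = g n].

Section Tower.
Variables (p : nat) (G : groupType) (g : nat -> G).
Hypotheses (p_pr : prime p) (tg : tower p g).

Lemma towerX n k : g (k + n) ^+ (p ^ k) = g n.
Proof.
have [_ _ gS] := tg; elim: k => [|k IH]; first by rewrite expg1.
by rewrite addSn expnS expgnA gS.
Qed.

(** Were [p ^ u = gcd (p ^ n, i)] with [u < n], the element
    [g_n ^ (p ^ u) = g_(n - u)] would be trivial, hence also its power [g_1]. *)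
Lemma tower_order n i : g n ^+ i = 1 <-> p ^ n %| i.
Proof.
have [g0 g1 _] := tg.
have gn : g n ^+ (p ^ n) = 1 by rewrite -g0 -[X in g X ^+ _]addn0 towerX.
split=> [gi|]; last exact: expg_dvdn_eq1.
have N0 : (0 < p ^ n)%N by rewrite expn_gt0 prime_gt0.
have [j e] := powers_gcd i N0 gn; rewrite gi expg1n in e.
have /(dvdn_pfactor _ _ p_pr)[u _ eu] := dvdn_gcdl (p ^ n) i.
have [nu|nu] := leqP n u.
  by apply: dvdn_trans (dvdn_exp2l p nu) _; rewrite -eu dvdn_gcdr.
case: g1; have <- : g n ^+ (p ^ n.-1) = g 1%N.
  by rewrite -(towerX 1 n.-1) addn1 prednK //; lia.
by rewrite (_ : n.-1 = u + (n.-1 - u))%N ?expnD ?expgnA -?eu ?e ?expg1n //; lia.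
Qed.

Lemma tower_comm m n : commute (g m) (g n).
Proof.
rewrite -(towerX m n) -(towerX n m) addnC.
exact/commuteX2/commute_refl.
Qed.

Lemma tower_mul m n i j :
  g m ^+ i * g n ^+ j = g (m + n) ^+ (p ^ n * i + p ^ m * j).
Proof. by rewrite expgnDr !expgnA towerX addnC towerX. Qed.

End Tower.

(** The Prufer p-group, as characterised by generators [g n] of its subgroups
    of order [p ^ n]. *)
Definition quasicyclic (p : nat) (G : groupType) : Prop :=
  exists g : nat -> G, tower p g /\ forall x, exists n i, x = g n ^+ i.

Lemma quasicyclic_iso p (G H : groupType) : prime p ->
  quasicyclic p G -> quasicyclic p H -> isomorphic G H.
Proof.
move=> p_pr [g [tg covG]] [h [th covH]].
apply: (@isomorphic_rel _ _ (fun x y => exists n i,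
  x = g n ^+ i /\ y = h n ^+ i)).
- by move=> x; have [n [i ->]] := covG x; exists (h n ^+ i), n, i.
- by move=> y; have [n [i ->]] := covH y; exists (g n ^+ i), n, i.
- move=> x y x' y' [m [i [-> ->]]] [n [j [-> ->]]].
  exists (m + n)%N, (p ^ n * i + p ^ m * j)%N.
  by rewrite (tower_mul tg) (tower_mul th).
- move=> x y [n [i [-> ->]]].
  apply: iff_trans (tower_order p_pr tg n i) _.
  exact: iff_sym (tower_order p_pr th n i).
Qed.

Lemma tower_prime_order p (G : groupType) (g : nat -> G) n i :
  prime p -> tower p g -> g n ^+ i <> 1 -> g n ^+ i ^+ p = 1 ->
  powers (g n ^+ i) (g 1%N) /\ powers (g 1%N) (g n ^+ i).
Proof.
move=> p_pr tg; case: n => [|n].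
  by have [-> _ _] := tg; rewrite expg1n.
move=> x1; rewrite -expgnA => /(tower_order p_pr tg).
rewrite expnSr dvdn_pmul2r ?prime_gt0 // => /dvdnP[j ej].
move: x1; rewrite {}ej mulnC expgnA.
have := towerX tg 1 n; rewrite addn1 => -> x1; split; last exact: powersX.
apply: (powers_prime_sym p_pr _ (powersX _ _) x1).
by have [g0 _ gS] := tg; rewrite gS.
Qed.

Lemma quasicyclic_one p (G : groupType) : prime p ->
  quasicyclic p G -> one_subgroup_of_order p G.
Proof.
move=> p_pr [g [tg cov]] x y.
have [n [i ->]] := cov x; have [m [j ->]] := cov y => x1 y1.
move=> /(tower_prime_order p_pr tg x1)[xg _].
by move=> /(tower_prime_order p_pr tg y1)[_ gy]; apply: powers_trans xg gy.
Qed.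

(** Given [x] in [A], infiniteness provides [c] in [A] outside [<x>], and
    comparability gives [x = c ^ i].  Here [p] divides [i], as otherwise [c]
    would be a power of [x]; so [c ^ (i / p)] is a p-th root of [x].  A tower
    of such roots exhausts [A]: an element killed by [p ^ k] cannot have
    [g_(k+1)] as a power, so it is a power of [g_(k+1)]. *)
Lemma comparable_tower (p : nat) (G : groupType) (A : set G) :
  prime p -> p_group p G -> infinite_set A ->
  (forall x n, A x -> A (x ^+ n)) ->
  (forall x y, A x -> A y -> powers x y \/ powers y x) ->
  exists g, [/\ tower p g, forall n, A (g n) &
    forall x, A x -> exists n i, x = g n ^+ i].
Proof.
move=> p_pr pG Ainf AX cmp.
have root x : {y | A x -> A y /\ y ^+ p = x}.
  apply: cid; have [Ax|nAx] := pselect (A x); last by exists x.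
  have [c [Ac xc]] : exists c, A c /\ ~ powers x c.
    apply: contrapT => nc; apply: Ainf.
    apply: sub_finite_set (finite_powers x pG).
    by move=> c Ac; apply: contrapT => xc; apply: nc; exists c.
  have [//|[i ei]] := cmp x c Ax Ac.
  have [/dvdnP[j ej]|pi] := boolP (p %| i).
    exists (c ^+ j) => _; split; first exact: AX.
    by rewrite ei ej expgnA.
  case: xc; have [k [N0 cN _]] := pG c.
  rewrite ei; apply: powers_coprime N0 cN _.
  by rewrite coprimeXl // prime_coprime.
have [x [Ax x1]] : exists x, A x /\ x <> 1.
  apply: contrapT => nx; apply: Ainf; apply: sub_finite_set (finite_set1 1).
  by move=> x Ax /=; apply: contrapT => x1; apply: nx; exists x.
have [y [[m yx] y1 yp]] := powers_prime_order p_pr pG x1.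
pose g n := if n is m.+1 then iter m (fun x => sval (root x)) y else 1.
have Ag n : A (g n).
  case: n => [|n]; first exact: (AX x 0 Ax).
  elim: n => [|n IH] /=; first by rewrite yx; apply: AX.
  by have [] := svalP (root _) IH.
have tg : tower p g.
  by split=> // -[|n] //; have [] := svalP (root _) (Ag n.+1).
exists g; split=> [//|n|z Az]; first exact: Ag.
have [k [_ zk _]] := pG z.
have [[i e]|[i e]] := cmp z (g k.+1) Az (Ag _); last by exists k.+1, i.
have /(tower_order p_pr tg) : g k.+1 ^+ (p ^ k) = 1.
  by rewrite e expgnAC zk expg1n.
by rewrite dvdn_Pexp2l ?prime_gt1 // ltnn.
Qed.

(** * Towers of quaternion type *)

Lemma invert_powers (G : groupType) (a b x : G) :
  b * a * b^-1 = a^-1 -> powers a x -> b * x * b^-1 = x^-1.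
Proof.
move=> ab [n ->]; rewrite -expVgn -ab.
by elim: n => [|n IH]; rewrite ?mulg1 ?mulgV // !expgS -IH !mulgA mulgVK.
Qed.

Lemma invert_coset (G : groupType) (a b c x : G) :
  b * a * b^-1 = a^-1 -> powers a (c * b^-1) -> powers a x ->
  c * x * c^-1 = x^-1.
Proof.
move=> ab [n e] ax.
have ec : c = a ^+ n * b by rewrite -e mulgVK.
have -> : c * x * c^-1 = a ^+ n * (b * x * b^-1) * (a ^+ n)^-1.
  by rewrite ec invgM !mulgA.
have [m ex] := ax; rewrite (invert_powers ab ax) ex.
have -> : commute (a ^+ n) (a ^+ m)^-1 by apply/commuteV/commuteX2/commute_refl.
by rewrite mulgK.
Qed.

(** [(u b) ^ 2 = u (b u b^-1) b ^ 2 = b ^ 2] for [u] in [<a>]. *)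
Lemma sqr_coset (G : groupType) (a b c : G) :
  b * a * b^-1 = a^-1 -> powers a (c * b^-1) -> c ^+ 2 = b ^+ 2.
Proof.
move=> ab ac; have := invert_powers ab ac.
rewrite invgM invgK -!mulgA => /mulgI e.
by apply: divg1_eq; rewrite !expg2 invgM -mulgA e mulgV.
Qed.

(** The group [Q_(2^oo)], as an extension of a Prufer 2-group with generators
    [g n] by an element [b] of order 4 inverting it. *)
Definition quaternion_tower (G : groupType) (g : nat -> G) (b : G) : Prop :=
  [/\ tower 2 g, forall n, b * g n * b^-1 = (g n)^-1, b ^+ 2 = g 1%N &
      forall x, exists n i e, x = g n ^+ i * b ^+ e].

Section QuaternionTower.
Variables (G : groupType) (g : nat -> G) (b : G).
Hypothesis qg : quaternion_tower g b.

Let tg : tower 2 g. Proof. by case: qg. Qed.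

Lemma quaternion_tower_flip n k e :
  b ^+ e * g n ^+ k = g n ^+ (if odd e then k * (2 ^ n).-1 else k)%N * b ^+ e.
Proof.
have [_ bgb _ _] := qg; set x := g n ^+ k.
have xV : x^-1 = g n ^+ (k * (2 ^ n).-1).
  rewrite /x mulnC expgnA -invg_expg_pred ?expn_gt0 ?expVgn //.
  exact/(tower_order _ tg).
have bx : b * x = x^-1 * b.
  by rewrite -(invert_powers (bgb n) (powersX _ k)) mulgVK.
have bxV : b * x^-1 = x * b.
  by apply: (mulgI x^-1); rewrite mulgA -bx mulgK mulKg.
suff -> : b ^+ e * x = (if odd e then x^-1 else x) * b ^+ e.
  by case: ifP => _ //; rewrite xV.
elim: e => [|e IH]; first by rewrite mul1g mulg1.
rewrite expgS -mulgA {}IH mulgA /=.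
by case: (odd e); rewrite /= (bx, bxV) -mulgA.
Qed.

(** Collecting [b] on the right gives exponents that depend on the given ones
    only, not on the group. *)
Lemma quaternion_tower_mul n i e m j f :
  (g n ^+ i * b ^+ e) * (g m ^+ j * b ^+ f) =
  g (n + m) ^+ (2 ^ m * i + 2 ^ n * (if odd e then j * (2 ^ m).-1 else j)%N)
     * b ^+ (e + f).
Proof.
by rewrite -mulgA (mulgA (b ^+ e)) quaternion_tower_flip -mulgA -expgnDr mulgA
  (tower_mul tg).
Qed.

(** For even [e] the normal form is a power of [g_(n+1)], as [b ^ 2 = g_1].  For
    odd [e] triviality would put [b] among the powers of the tower, making [b]
    commute with [g_2], which it inverts and which has order 4. *)
Lemma quaternion_tower_eq1 n i e :
  g n ^+ i * b ^+ e = 1 <-> ~~ odd e && (2 ^ n.+1 %| 2 * i + 2 ^ n * e./2).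
Proof.
have [_ bgb b2 _] := qg; have [_ g1 _] := tg.
have even m : g n ^+ i * b ^+ (m.*2) = g n.+1 ^+ (2 * i + 2 ^ n * m).
  by rewrite -mul2n expgnA b2 (tower_mul tg) addn1 expn1.
have [oe|ee] := boolP (odd e); last first.
  by rewrite -{1}(even_halfK ee) even; apply: (tower_order _ tg).
split=> // E; case: g1.
have cb : commute b (g 2%N).
  suff -> : b = (g n ^+ i * b ^+ (e./2.*2))^-1.
    by rewrite even; apply/commute_sym/commuteV/commuteX/(tower_comm tg).
  apply: (mulgI (g n ^+ i * b ^+ (e./2.*2))); rewrite mulgV -E -mulgA -expgSr.
  by rewrite -[in RHS](odd_double_half e) oe.
have := bgb 2%N; rewrite cb mulgK => g2.
by have [_ _ /(_ 1%N)] := tg; rewrite expg2 {2}g2 mulgV.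
Qed.

(** An element outside the tower squares to [g_1], so the elements of order 2
    are those of the tower. *)
Lemma quaternion_tower_one : one_subgroup_of_order 2 G.
Proof.
have [_ _ b2 cov] := qg.
suff inv z : z <> 1 -> z ^+ 2 = 1 -> powers z (g 1%N) /\ powers (g 1%N) z.
  move=> x y x1 y1 /(inv _ x1)[xg _] /(inv _ y1)[_ gy].
  exact: powers_trans xg gy.
have [n [i [e ->]]] := cov z.
have [oe _ E|ee] := boolP (odd e); last first.
  rewrite -(even_halfK ee) -mul2n expgnA b2 (tower_mul tg).
  exact: (tower_prime_order _ tg).
exfalso; move: E; rewrite expg2 quaternion_tower_mul oe.
move/quaternion_tower_eq1.
rewrite addnn odd_double doubleK /=.
have -> : (2 ^ n * i + 2 ^ n * (i * (2 ^ n).-1) = 2 ^ n * 2 ^ n * i)%N.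
  by rewrite -mulnDr -mulnS prednK ?expn_gt0 // -mulnA (mulnC i).
rewrite -expnD expnS; set M := (2 ^ (n + n))%N.
have -> : (2 * (M * i) + M * e = M * (2 * i + e))%N by lia.
by rewrite mulnC dvdn_pmul2l ?expn_gt0 // dvdn2 oddD oddM oe.
Qed.

End QuaternionTower.

Definition quasiquaternion (G : groupType) : Prop :=
  exists (g : nat -> G) b, quaternion_tower g b.

Lemma quasiquaternion_iso (G H : groupType) :
  quasiquaternion G -> quasiquaternion H -> isomorphic G H.
Proof.
move=> [g [b qg]] [h [c qh]].
have [_ _ _ covG] := qg; have [_ _ _ covH] := qh.
apply: (@isomorphic_rel _ _ (fun x y => exists n i e,
  x = g n ^+ i * b ^+ e /\ y = h n ^+ i * c ^+ e)).
- move=> x; have [n [i [e ->]]] := covG x.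
  by exists (h n ^+ i * c ^+ e), n, i, e.
- move=> y; have [n [i [e ->]]] := covH y.
  by exists (g n ^+ i * b ^+ e), n, i, e.
- move=> x y x' y' [m [i [e [-> ->]]]] [n [j [f [-> ->]]]].
  do 3!eexists.
  by rewrite (quaternion_tower_mul qg) (quaternion_tower_mul qh).
- move=> x y [n [i [e [-> ->]]]].
  apply: iff_trans (quaternion_tower_eq1 qg n i e) _.
  exact: iff_sym (quaternion_tower_eq1 qh n i e).
Qed.

(** * Finite p-groups with one subgroup of order p *)

Section FiniteSubgroup.
Variables (G : groupType) (s : seq G).
(** The closure proof is an argument so that the group structure can be
    attached to the type of the entries of [s]; this turns a finite subgroup of
    a possibly infinite group into a [finGroupType]. *)
Definition closed_seq (_ : group_closed [in s]) : Type := seq_sub s.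
Variable sG : group_closed [in s].
HB.instance Definition _ := SubFinite.copy (closed_seq sG) (seq_sub s).
HB.instance Definition _ :=
  SubChoice_isSubGroup.Build G [in s] (closed_seq sG) sG.
End FiniteSubgroup.

(** The elements of order dividing [p] generate a group of order [p], namely
    ['Ohm_1], and the finite p-groups with this property are classified. *)
Lemma pgroup_cyclic_or_quaternion (gT : finGroupType) p : prime p ->
  p.-group [set: gT]%SET ->
  (forall x y : gT, x != 1 -> y != 1 -> x ^+ p = 1 -> y ^+ p = 1 ->
    y \in <[x]>) ->
  (exists c, forall x : gT, x \in <[c]>) \/
  (p = 2 /\ exists a b : gT,
   [/\ b * a * b^-1 = a^-1, b ^+ 2 != 1, b ^+ 4 = 1 &
     forall x : gT, x \in <[a]> \/ x * b^-1 \in <[a]> ]).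
Proof.
move=> p_pr pG uniq_p.
have [G1|ntG] := eqVneq [set: gT]%SET 1.
  by left; exists 1 => x; rewrite cycle1 -G1 inE.
have : #|'Ohm_1([set: gT]%SET)| = p.
  have [_ pd _] := pgroup_pdiv pG ntG; have [z _ oz] := Cauchy p_pr pd.
  rewrite -oz orderE; suff -> : 'Ohm_1([set: gT]%SET)%g = <[z]> by [].
  apply/eqP; rewrite finset.eqEsubset (OhmE 1 pG) expn1; apply/andP; split.
    rewrite gen_subG; apply/fintype.subsetP => x; rewrite !inE /= => /eqP xp.
    have [->|x1] := eqVneq x 1; first exact: group1.
    apply: uniq_p => //; last by rewrite -oz expg_order.
    by rewrite -order_gt1 oz prime_gt1.
  by rewrite cycle_subG mem_gen // !inE /= -oz expg_order.
move/(prime_Ohm1P pG ntG)/orP=> [/cyclicP[c Gc]|/andP[/eqP p2 /eqP]].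
  by left; exists c => x; rewrite -Gc inE.
rewrite p2 => /quaternion_classP[n n2 iso]; right; split=> //.
have [[a b] gen [ob b2 ab]] := generators_quaternion n2 iso.
exists a, b; split.
- rewrite (conjgCV b a) mulgK; apply: (@conjg_inj _ b).
  by rewrite conjgKV conjVg ab invgK.
- by rewrite -order_dvdn ob.
- by rewrite -ob expg_order.
move=> x.
have [_ _ _ XY _] := extremal_generators_facts (isT : prime 2) gen.
have : x \in <[a]> * <[b]> by rewrite XY inE.
case/mulsgP=> u _ Xu /cycleP[k ->] ->.
have Xb2 i : b ^+ (i.*2) \in <[a]>.
  by rewrite -mul2n expgnA b2 groupX // mem_cycle.
rewrite -(odd_double_half k); case: (odd k); last first.
  by left; rewrite groupM // Xb2.
by right; rewrite addnC addn1 expgSr mulgA mulgK groupM.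
Qed.

Definition cyclic_or_quaternion (p : nat) (G : groupType) (s : seq G) : Prop :=
  (exists c, forall x, x \in s -> powers c x) \/
  (p = 2 /\ exists a b : G,
   [/\ b * a * b^-1 = a^-1, b ^+ 2 <> 1, b ^+ 4 = 1 &
     forall x, x \in s -> powers a x \/ powers a (x * b^-1)]).

Lemma finite_seq_cyclic_or_quaternion (p : nat) (G : groupType) : prime p ->
  locally_finite G -> p_group p G -> one_subgroup_of_order p G ->
  forall s : seq G, cyclic_or_quaternion p s.
Proof.
move=> p_pr lfG pG oneG s.
have : finite_set (generated [set` s]).
  by apply: lfG; exists [set` s]; split=> //; exact: finite_seq.
move=> /finite_seqP[t gent].
have st x : x \in s -> x \in t.
  move=> xs; suff : generated [set` s] x by rewrite gent.
  by move=> A [_]; apply.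
have tG : group_closed [in t].
  have gt x : x \in t <-> generated [set` s] x by rewrite gent.
  have ht x : x \in [in t] = (x \in t) by [].
  split; first by rewrite ht; apply/gt => A [[]].
  move=> x y; rewrite !ht => /gt xt /gt yt; apply/gt => A As.
  have [[A1 AM AV] _] := As; apply: AM; first exact: xt.
  by apply: AV; exact: yt.
pose gT : finGroupType := closed_seq tG.
have valX (x : gT) n : val (x ^+ n) = val x ^+ n by rewrite gmulfXn.
have val1 : val (1 : gT) = 1 by rewrite gmulf1.
have val_eq1 (x : gT) : val x = 1 -> x = 1.
  by move=> h; apply: val_inj; rewrite val1.
have lift x : x \in s -> {x' : gT | x = val x'}.
  by move=> /st xt; exists (SeqSub xt).
have pow (x y : gT) : y \in <[x]> -> powers (val x) (val y).
  by case/cycleP=> k ->; exists k; rewrite valX.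
have pgT : p.-group [set: gT]%SET.
  apply/pgroupP => q q_pr /(Cauchy q_pr)[x _ ox].
  have [k [_ xk _]] := pG (val x).
  have : q %| p ^ k.
    by rewrite -ox order_dvdn; apply/eqP/val_eq1; rewrite valX.
  by rewrite Euclid_dvdX // => /andP[+ _]; rewrite dvdn_prime2 // inE.
have [|[c gc]|[p2 [a [b [ab b2 b4 cov]]]]] :=
  pgroup_cyclic_or_quaternion p_pr pgT.
- move=> x y /eqP x1 /eqP y1 xp yp.
  have [|||//|n e] := oneG (val x) (val y).
  - by move=> /val_eq1.
  - by move=> /val_eq1.
  - by rewrite -valX xp.
  - by rewrite -valX yp.
  by apply/cycleP; exists n; apply: val_inj; rewrite valX.
- by left; exists (val c) => x /lift[x' ->]; apply: pow.
- right; split=> //; exists (val a), (val b); split.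
  - by rewrite -gmulfV -!gmulfM ab gmulfV.
  - by rewrite -valX => /val_eq1/eqP; rewrite (negPf b2).
  - by rewrite -valX b4.
  - move=> x /lift[x' ->]; rewrite -gmulfV -gmulfM.
    by have [/pow|/pow] := cov x'; [left|right].
Qed.

(** * Classification of the infinite groups *)

Lemma infinite_uniq (T : choiceType) n : infinite_set [set: T] ->
  exists s : seq T, uniq s /\ size s = n.
Proof.
move=> Tinf; elim: n => [|n [s [us <-]]]; first by exists [::].
have [x xs] : exists x, x \notin s.
  apply: contrapT => nx; apply: Tinf; apply: sub_finite_set (finite_seq s).
  by move=> x _ /=; apply/negPn/negP => xs; apply: nx; exists x.
by exists (x :: s); rewrite /= xs.
Qed.

Definition locally_cyclic (G : groupType) : Prop :=
  forall s : seq G, exists c, forall x, x \in s -> powers c x.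

Lemma quasicyclic_of_locally_cyclic (p : nat) (G : groupType) : prime p ->
  infinite_set [set: G] -> p_group p G -> locally_cyclic G -> quasicyclic p G.
Proof.
move=> p_pr Ginf pG cyc.
have [||g [tg _ cov]] := comparable_tower p_pr pG Ginf; first by [].
  move=> x y _ _; have [c cxy] := cyc [:: x; y].
  apply: (powers_total p_pr pG (c := c)); apply: cxy;
  by rewrite !inE eqxx ?orbT.
by exists g; split=> // x; apply: cov.
Qed.

(** The tower lives in the set [A] of powers of elements of order at least 8:
    in any finite quaternion piece [<a> U <a>b] the elements of [<a>b] have
    order 4, so [A] meets it inside [<a>]. *)
Lemma quasiquaternion_of_not_locally_cyclic (p : nat) (G : groupType) :
  prime p -> infinite_set [set: G] -> locally_finite G -> p_group p G ->
  one_subgroup_of_order p G -> ~ locally_cyclic G -> quasiquaternion G.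
Proof.
move=> p_pr Ginf lfG pG oneG /existsNP[s0 ncyc].
have dich := finite_seq_cyclic_or_quaternion p_pr lfG pG oneG.
have p2 : p = 2%N by have [/ncyc|[]] := dich s0.
subst p.
(* Adding [s0] to a finite set rules out the cyclic case. *)
have quat (s : seq G) : exists a b : G,
    [/\ b * a * b^-1 = a^-1, b ^+ 2 <> 1, b ^+ 4 = 1 &
     forall x, x \in s -> powers a x \/ powers a (x * b^-1)].
  have [[c cs]|[_ [a [b [ab b2 b4 cov]]]]] := dich (s ++ s0).
    by case: ncyc; exists c => x xs; apply: cs; rewrite mem_cat xs orbT.
  by exists a, b; split=> // x xs; apply: cov; rewrite mem_cat xs.
have axis (a b d : G) : b * a * b^-1 = a^-1 -> b ^+ 4 = 1 -> d ^+ 4 <> 1 ->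
    powers a d \/ powers a (d * b^-1) -> powers a d /\ a ^+ 4 <> 1.
  move=> ab b4 d4 [ad|ad].
    split=> // a4; case: d4; have [n ->] := ad.
    by rewrite expgnAC a4 expg1n.
  by case: d4; rewrite (expgnA d 2 2) (sqr_coset ab ad) -expgnA.
(* In exponent 4 a piece has at most 8 elements, so 9 elements do not fit. *)
have [c c4] : exists c : G, c ^+ 4 <> 1.
  apply: contrapT => /forallNP/= nc; have {}nc x : x ^+ 4 = 1 :> G.
    by apply: contrapT; apply: nc.
  have [s [us sz]] := infinite_uniq 9 Ginf.
  have [a [b [_ _ _ cov]]] := quat s.
  have : {subset s <= [seq a ^+ i * b ^+ e | i <- iota 0 4, e <- iota 0 2]}.
    have lt4 n : exists2 i, a ^+ n = a ^+ i & i \in iota 0 4.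
      by exists (n %% 4)%N; rewrite ?expg_modn // mem_iota ltn_mod.
    move=> x /cov[|] [n e]; have [i ei i4] := lt4 n; apply/allpairsP.
      by exists (i, 0%N); rewrite /= mulg1 e ei; split.
    by exists (i, 1%N); rewrite /= expg1 -ei -e mulgVK; split.
  by move/(uniq_leq_size us); rewrite sz.
pose A := [set x : G | exists d, d ^+ 4 <> 1 /\ powers d x].
have AX x n : A x -> A (x ^+ n).
  by move=> [d [d4 dx]]; exists d; split=> //; apply: powers_expg.
have cmp x y : A x -> A y -> powers x y \/ powers y x.
  move=> [d [d4 dx]] [e [e4 ey]].
  have [a [b [ab _ b4 cov]]] := quat [:: d; e].
  have [|ad _] := axis a b d ab b4 d4; first by apply: cov; rewrite inE eqxx.
  have [|ae _] := axis a b e ab b4 e4.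
    by apply: cov; rewrite !inE eqxx orbT.
  apply: (powers_total p_pr pG (c := a)); first exact: powers_trans dx.
  exact: powers_trans ey.
(* In a piece with [a] of order at least 8, membership of [b] in [A] would make
   [b] commute with [a], which it inverts. *)
have [b0 nAb0] : exists b, ~ A b.
  have [a [b [ab _ b4 cov]]] := quat [:: c].
  have [|ac a4] := axis a b c ab b4 c4; first by apply: cov; rewrite inE eqxx.
  exists b => Ab; have Aa : A a by exists a; split=> //; apply: powers_refl.
  have cb : commute b a.
    have [[n ->]|[n ->]] := cmp a b Aa Ab; last exact/commuteX/commute_refl.
    exact/commute_sym/commuteX/commute_refl.
  case: a4; move: ab; rewrite cb mulgK => aV.
  by rewrite (expgnA a 2 2) (expg2 a) {2}aV mulgV expg1n.
(* Adding [c] and [b0] to a finite set ensures that [<a>] is contained in [A]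
   and that [b0] lies in the other coset [<a>b]. *)
have quat0 (s : seq G) : exists a b : G,
    [/\ b * a * b^-1 = a^-1, a ^+ 4 <> 1, powers a (b0 * b^-1),
     b ^+ 2 <> 1 /\ b ^+ 4 = 1 &
     forall x, x \in s -> powers a x \/ powers a (x * b^-1)].
  have [a [b [ab b2 b4 cov]]] := quat [:: c, b0 & s].
  have [|ac a4] := axis a b c ab b4 c4; first by apply: cov; rewrite inE eqxx.
  exists a, b; split=> //; last first.
    by move=> x xs; apply: cov; rewrite !inE xs !orbT.
  have [|ab0|//] := cov b0; first by rewrite !inE eqxx orbT.
  by case: nAb0; exists a.
have coset x : A x \/ A (x * b0^-1).
  have [a [b [ab a4 ab0 [b2 b4] cov]]] := quat0 [:: x].
  have [|ax|ax] := cov x; first by rewrite inE.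
    by left; exists a.
  right; exists a; split=> //.
  have -> : x * b0^-1 = (x * b^-1) * (b0 * b^-1)^-1.
    by rewrite invgM invgK mulgA mulgVK.
  move: ax ab0 => [i ->] [j ->]; have [k [N0 ak _]] := pG a.
  exists (i + (2 ^ k).-1 * j)%N.
  by rewrite expgnDr expgnA -invg_expg_pred // expVgn.
have Ainf : infinite_set A.
  move=> Afin; apply: Ginf.
  apply: (@sub_finite_set _ _ (A `|` [set x * b0 | x in A])); last first.
    by rewrite finite_setU; split=> //; apply: finite_image.
  move=> x _; have [|Ax] := coset x; first by left.
  by right; exists (x * b0^-1) => //; rewrite mulgVK.
have [g [tg Ag cov]] := comparable_tower p_pr pG Ainf AX cmp.
exists g, b0; split=> //.
- move=> n; have [d [d4 dg]] := Ag n.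
  have [a [b [ab a4 ab0 [b2 b4] acov]]] := quat0 [:: d].
  have [|ad _] := axis a b d ab b4 d4; first by apply: acov; rewrite inE eqxx.
  by apply: (invert_coset ab ab0); apply: powers_trans dg.
- have [a [b [ab a4 ab0 [b2 b4] _]]] := quat0 [::].
  have [g0 g1 gS] := tg; have g1p : g 1%N ^+ 2 = 1 by rewrite gS.
  rewrite (sqr_coset ab ab0); have [|n e] := oneG _ (b ^+ 2) g1 b2 g1p.
    by rewrite -expgnA.
  (* A nontrivial power of an element of order 2 is that element. *)
  move: b2; rewrite e -(expg_modn n g1p).
  by case: (n %% 2) (ltn_pmod n (isT : 0 < 2)%N) => [|[|]].
- move=> x; have [/cov[n [i ->]]|/cov[n [i e]]] := coset x.
    by exists n, i, 0%N; rewrite mulg1.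
  by exists n, i, 1%N; rewrite expg1 -e mulgVK.
Qed.

(** * The Prufer group *)

Definition rat_class (r : rat) : Algebra.to_multiplicative rat_mod_int :=
  (\pi_(rat_mod_int) r)%qT.

Lemma rat_class_eq r s : rat_class r = rat_class s <-> (r - s)%R \is a Num.int.
Proof.
have e : ((r - s)%R \is a Num.int) =
    (\pi_(rat_mod_int) r == \pi_(rat_mod_int) s)%qT.
  exact: (Quotient.idealrBE rat_int r s).
by rewrite e; split=> [/eqP|/eqP].
Qed.

Lemma rat_classX r n : rat_class (r *+ n)%R = rat_class r ^+ n.
Proof.
elim: n => [|n IH].
  by rewrite mulr0n; apply: (raddf0 (\pi_(rat_mod_int)%qT)).
rewrite mulrS expgS -IH; exact: (Quotient.pi_add rat_int r (r *+ n)%R).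
Qed.

Lemma rat_class_eq1 r : rat_class r = 1 <-> r \is a Num.int.
Proof.
have := rat_class_eq r 0.
by rewrite subr0 (rat_classX 0 0 : rat_class 0 = 1).
Qed.

(** The tower is [1 / q ^ n] modulo 1: a rational [r] with [q ^ k * r] integral
    is [z / q ^ k] for an integer [z], which matters modulo [q ^ k] only. *)
Lemma prufer_quasicyclic q : prime q -> quasicyclic q (prufer q).
Proof.
move=> q_pr.
have q0 n : (q%:R ^+ n != 0 :> rat)%R.
  by rewrite expf_neq0 // pnatr_eq0 -lt0n prime_gt0.
have frac1 n : (q%:R ^- n *+ (q ^ n)%N = 1 :> rat)%R.
  by rewrite -[LHS]mulr_natr natrX mulVf.
pose u n := rat_class (q%:R ^- n)%R.
have unit_frac n k : rat_class ((q%:R ^- n) *+ k)%R = u n ^+ k.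
  exact: rat_classX.
have up n : primary_pred q (u n).
  apply/asboolP; exists n; rewrite -unit_frac; apply/rat_class_eq1.
  by rewrite frac1.
pose g n : prufer q := Prufer (up n).
have valX (x : prufer q) n : val (x ^+ n) = val x ^+ n by rewrite gmulfXn.
have val1 : val (1 : prufer q) = 1 by rewrite gmulf1.
exists g; split.
  split.
  - by apply: val_inj; rewrite val1; apply/rat_class_eq1; rewrite expr0 invr1.
  - move=> /(congr1 val); rewrite val1 => /rat_class_eq1 /intrP[z].
    move/(congr1 (fun r => r * q%:R)%R); rewrite expr1 mulVf ?(q0 1%N) //.
    rewrite -[1%R]/(1%:~R)%R -[(q%:R)%R]/(q%:~R)%R -intrM => /intr_inj/esym.
    move/(congr1 absz); rewrite abszM => /eqP.
    rewrite muln_eq1 => /andP[_ /eqP q1].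
    by move: q_pr; rewrite -[q]absz_nat q1.
  - move=> n; apply: val_inj; rewrite valX /= -unit_frac; congr rat_class.
    by rewrite -[LHS]mulr_natr exprS invfM mulrAC mulVf ?mul1r // (q0 1%N).
move=> x; have /asboolP[k] := valP x.
have [r er] : exists r, val x = rat_class r.
  exists (generic_quotient.repr (val x : rat_mod_int)).
  by rewrite /rat_class generic_quotient.reprK.
rewrite er -rat_classX => /rat_class_eq1/intrP[z ez].
pose Q : int := (q ^ k)%N.
have Q0 : Q != 0%R by rewrite eqz_nat expn_eq0 negb_and -lt0n prime_gt0.
exists k, `|(z %% Q)%Z|%N; apply: val_inj; rewrite valX /= -unit_frac.
rewrite er; apply/rat_class_eq.
have -> : (r = z%:~R * q%:R ^- k)%R.
  by rewrite -ez -(mulr_natr r) natrX mulfK.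
have -> : (q%:R ^- k *+ `|(z %% Q)%Z| = (z %% Q)%Z%:~R * q%:R ^- k :> rat)%R.
  rewrite -(mulr_natr (q%:R ^- k)) -[X in (_ * X)%R]/((`|(z %% Q)%Z|%:Z)%:~R)%R.
  by rewrite gez0_abs ?modz_ge0 // mulrC.
rewrite -mulrBl -rmorphB /= {1}(divz_eq z Q) addrK intrM -mulrA.
by rewrite [(Q%:~R)%R]natrX divff // mulr1 intr_int.
Qed.

(** * The union of the quaternion groups *)

HB.instance Definition _ (G : nat -> groupType)
    (phi : forall n, {multiplicative G n -> G n.+1}) n :=
  isMultiplicative.Build (G n) (chain_limit phi) (@chain_in G phi n)
    (@chain_inM G phi n).

Lemma chain_in_step (G : nat -> groupType)
    (phi : forall n, {multiplicative G n -> G n.+1}) n (x : G n) :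
  chain_in phi (phi n x) = chain_in phi x.
Proof. exact: (pi_steps phi 1 (Tagged G x)). Qed.

(** Detected in the finite generalized quaternion group, which satisfies the
    relations with a [b] of order 4. *)
Lemma quaternion_b2 n : (2 < n)%N -> quaternion_b n ^+ 2 <> 1.
Proof.
move=> n2; have [[x y] _ [oy y2 xy]] :=
  generators_quaternion n2 (isog_refl 'Q_((2 ^ n)%N)%G).
pose f (c : bool) := if c then y else x.
have fR : forall u v, quaternion_rel n u v -> eval_word f u = eval_word f v.
  apply: eval_quaternion_rel; rewrite /= ?y2 ?subn2 //.
    rewrite (conjgCV y x) mulgK; apply: (@conjg_inj _ y).
    by rewrite conjgKV conjVg xy invgK.
  by rewrite -oy expg_order.
move=> b2; pose lift := presented_lift (R := quaternion_rel n) f.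
have : lift (quaternion_b n ^+ 2) = 1.
  rewrite b2 /lift /presented_lift (eval_word_cong fR (word_cong_repr _ _)).
  by rewrite /eval_word big_nil.
rewrite expg2 /lift (presented_liftM fR) (presented_lift_gen fR) /= -expg2.
by move/eqP; rewrite -order_dvdn oy.
Qed.

(** The normal forms are stable under left multiplication by [a] and [b], and
    by their inverses, which are powers. *)
Lemma quaternion_normal_form n (x : quaternion n) :
  exists i e, x = quaternion_a n ^+ i * quaternion_b n ^+ e.
Proof.
have [ab conj b4] := quaternion_relations n.
set a := quaternion_a n in ab conj *; set b := quaternion_b n in ab conj b4 *.
pose S z := exists i e, z = a ^+ i * b ^+ e.
have SV (c z : quaternion n) N : (0 < N)%N -> c ^+ N = 1 ->
    (forall z, S z -> S (c * z)) -> S z -> S (c^-1 * z).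
  move=> N0 cN cS Sz; rewrite (invg_expg_pred N0 cN).
  by elim: N.-1 => [|m IH]; rewrite ?mul1g // expgS -mulgA; apply: cS.
have Sa z : S z -> S (a * z).
  by move=> [i [e ->]]; exists i.+1, e; rewrite expgS mulgA.
have N0 : (0 < 2 ^ (n - 2) * 2)%N by rewrite muln_gt0 expn_gt0.
have aN : a ^+ (2 ^ (n - 2) * 2) = 1 by rewrite expgnA ab -expgnA.
have Sb z : S z -> S (b * z).
  move=> [i [e ->]]; exists ((2 ^ (n - 2) * 2).-1 * i)%N, e.+1.
  rewrite expgnA -(invg_expg_pred N0 aN) expVgn.
  by rewrite -(invert_powers conj (powersX a i)) expgS !mulgA mulgVK.
rewrite -[x]generic_quotient.reprK -presented_eval.
elim: (generic_quotient.repr x) => [|[c s] w IH].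
  by exists 0%N, 0%N; rewrite /eval_word big_nil mulg1.
rewrite /eval_word big_cons -/(eval_word _ w) /eval_letter /=.
case: c s => [] [].
- by apply: (@SV b _ 4).
- exact: Sb.
- by apply: SV N0 aN _ _.
- exact: Sa.
Qed.

(** At level [n] the element [a] has order [2 ^ (n + 2)], so its fourth power is
    the element [g n] of order [2 ^ n] of the tower.  The tower is nontrivial
    because [g 1 = b ^ 2], [b] is the same at all levels, and [b ^ 2] is trivial
    at none. *)
Lemma quasiquaternion_infty : quasiquaternion quaternion_infty.
Proof.
pose Q i := quaternion i.+3.
pose phi i : {multiplicative Q i -> Q i.+1} := @quaternion_embed i.
pose inc n : {multiplicative Q n -> quaternion_infty} := @chain_in Q phi n.
pose a n : Q n := quaternion_a n.+3; pose b n : Q n := quaternion_b n.+3.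
have incS n (x : Q n) : inc n.+1 (phi n x) = inc n x by exact: chain_in_step.
have phia n : phi n (a n) = a n.+1 ^+ 2 by exact: quaternion_embed_a.
have phib n : phi n (b n) = b n.+1 by exact: quaternion_embed_b.
pose g n := inc n (a n ^+ 4).
have incX n (x : Q n) k : inc n (x ^+ k) = inc n x ^+ k by exact: homomorphismX.
have gE n : g n.+2 = inc n (a n).
  rewrite /g -(incS n) phia -(incS n.+1).
  by rewrite (homomorphismX (phi n.+1)) phia -expgnA.
have incb n : inc n (b n) = inc 0%N (b 0%N).
  by elim: n => // n <-; rewrite -phib incS.
have rel n := quaternion_relations n.+3.
have b2 : inc 0%N (b 0%N) ^+ 2 = g 1%N.
  have [ab _ _] := rel 1%N.
  by rewrite /g -(incb 1%N) -incX; congr (inc _ _); rewrite -ab.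
exists g, (inc 0%N (b 0%N)); split=> //.
- split.
  + rewrite /g; have [ab _ b4] := rel 0%N.
    by rewrite /a (expgnA _ 2 2) ab -expgnA b4; apply: homomorphism1.
  + rewrite -b2 -incX => /(@limit_eq Q phi)[k [l]].
    have -> : chain_steps phi k (Tagged Q (b 0%N ^+ 2)) = Tagged Q (b k ^+ 2).
      by elim: k => //= k ->; rewrite /chain_step /= homomorphismX phib.
    move=> e; apply: (@quaternion_b2 k.+3 isT).
    (* Tagged elements of different levels have different types, so triviality
       is compared through a predicate on the whole chain. *)
    pose P (u : chain_elt Q) := tagged u = 1.
    rewrite -/(P (Tagged Q (b k ^+ 2))) e.
    by elim: l {e} => //= l IH; rewrite /P /chain_step /= IH homomorphism1.
  + move=> n; rewrite /g -incX -expgnA -(incS n).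
    by rewrite (homomorphismX (phi n)) phia -expgnA.
- move=> n; rewrite -(incb n) /g -[RHS]homomorphismV -homomorphismV -!gmulfM.
  congr (inc _ _); have [_ conj _] := rel n.
  exact: (invert_powers conj (powersX _ 4)).
- move=> x; have [y ->] := @limit_level Q phi _ x (leqnn _).
  set n := tag _ in y *.
  have [i [e ->]] := @quaternion_normal_form n.+3 y.
  exists n.+2, i, e; rewrite gE -(incb n) -!incX.
  exact: (@chain_inM Q phi n (a n ^+ i) (b n ^+ e)).
Qed.

Theorem theorem12 (p : nat) (G : groupType) (p_prime : prime p)
    (G_infinite : infinite_set [set: G])
    (G_locally_finite : locally_finite G) (G_p_group : p_group p G) :
  connected (proper_power_graph G) <->
  (exists q : nat, prime q /\ isomorphic G (prufer q)) \/
  isomorphic G quaternion_infty.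
Proof.
split=> [/(connected_one_subgroup p_prime G_p_group) oneG|].
  have [cyc|ncyc] := pselect (locally_cyclic G).
    left; exists p; split=> //; apply: (quasicyclic_iso p_prime).
      exact: (quasicyclic_of_locally_cyclic p_prime).
    exact: prufer_quasicyclic.
  right; apply: quasiquaternion_iso quasiquaternion_infty.
  exact: (quasiquaternion_of_not_locally_cyclic p_prime).
case=> [[q [q_pr iso]]|iso].
  have [g [tg cov]] := prufer_quasicyclic q_pr.
  apply: (connected_of_isomorphic p_prime q_pr G_p_group iso).
    by apply: quasicyclic_one => //; exists g.
  by have [g0 g1 gS] := tg; exists (g 1%N); rewrite gS.
have [g [b qg]] := quasiquaternion_infty.
apply: (connected_of_isomorphic p_prime (isT : prime 2) G_p_group iso).
  exact: quaternion_tower_one qg.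
by have [[g0 g1 gS] _ _ _] := qg; exists (g 1%N); rewrite gS.
Qed.
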